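(* Let $G$ be a nontrivial connected graph with $m$ edges. Then $\mathrm{scfc}(G)=m$ if and only if $G$ is isomorphic to the star $S_m$.
   Context: All graphs are finite, simple and undirected; nontrivial means having at least two vertices. $S_m$ denotes the star with $m$ edges. Edge-colorings are arbitrary (adjacent edges may receive the same color). A path in an edge-colored graph is conflict-free if some color is used on exactly one of its edges. An edge-colored graph $G$ is strongly conflict-free connected if for every pair of distinct vertices $u,v$ there is a conflict-free path of length $d_G(u,v)$ connecting them. For a connected graph $G$, $\mathrm{scfc}(G)$ is the smallest number of colors in an edge-coloring making $G$ strongly conflict-free connected. *)

(* Defs.v *)
From mathcomp Require Import all_boot.

Set Implicit Arguments.
Unset Strict Implicit.
Unset Printing Implicit Defensive.

Record sgraph := SGraph {
  vertex :> finType;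
  adj : rel vertex;
  adj_sym : symmetric adj;
  adj_irr : irreflexive adj }.

Definition edges (G : sgraph) : {set {set G}} :=
  [set [set x.1; x.2] | x : G * G & adj x.1 x.2].

Definition edge (G : sgraph) := {e : {set G} | e \in edges G}.

Definition connected (G : sgraph) := forall x y : G, connect (@adj G) x y.

Definition isomorphic (G H : sgraph) :=
  exists2 f : G -> H, bijective f & forall x y, adj (f x) (f y) = adj x y.

Section Star.
Variable m : nat.

(* ord0 is the centre, the m other vertices are the leaves *)
Definition star_adj : rel 'I_m.+1 := fun i j => (i == ord0) != (j == ord0).

Lemma star_adj_sym : symmetric star_adj.
Proof. by move=> i j; rewrite /star_adj eq_sym. Qed.

Lemma star_adj_irr : irreflexive star_adj.
Proof. by move=> i; rewrite /star_adj eqxx. Qed.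

Definition star := SGraph star_adj_sym star_adj_irr.

End Star.

(* The path u :: p from u to v; its length is size p *)
Definition is_path (G : sgraph) (u v : G) (p : seq G) :=
  [&& path (@adj G) u p, uniq (u :: p) & last u p == v].

Definition path_edges (G : sgraph) (u : G) (p : seq G) : {set {set G}} :=
  [set:: pairmap (fun x y => [set x; y]) u p].

Lemma dist_ex (G : sgraph) (Gc : connected G) (u v : G) :
  exists n, [exists p : n.-tuple G, is_path u v p].
Proof.
have /connectP [p pth ->] := Gc u v.
case: (shortenP pth) => q qth qu _; exists (size q).
by apply/existsP; exists (in_tuple q); rewrite /is_path /= qth eqxx andbT.
Qed.

Definition dist (G : sgraph) (Gc : connected G) (u v : G) : nat :=
  ex_minn (dist_ex Gc u v).

(* Vertices do not repeat along a path, so neither do edges, and counting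
   the edges of colour i in the set path_edges u p is no loss. *)
Definition conflict_free (G : sgraph) (k : nat) (c : {ffun edge G -> 'I_k})
    (u : G) (p : seq G) :=
  [exists i : 'I_k,
    #|[set e : edge G | (val e \in path_edges u p) && (c e == i)]| == 1].

Definition strongly_cf_connected (G : sgraph) (Gc : connected G) (k : nat)
    (c : {ffun edge G -> 'I_k}) :=
  [forall u : G, forall v : G, (u != v) ==>
    [exists p : (dist Gc u v).-tuple G, is_path u v p && conflict_free c u p]].

Lemma scfc_ex (G : sgraph) (Gc : connected G) :
  exists k, [exists c : {ffun edge G -> 'I_k}, strongly_cf_connected Gc c].
Proof.
exists #|{: edge G}|; apply/existsP; exists [ffun e => enum_rank e].
apply/forallP=> u; apply/forallP=> v; apply/implyP=> uv.
rewrite /dist; case: ex_minnP => n /existsP[p hp] _.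
apply/existsP; exists p; rewrite hp /=.
case: (tval p) hp => [|x q]; first by rewrite /is_path /= (negPf uv).
case/and3P=> /= /andP[ux _] _ _.
have E : [set u; x] \in edges G.
  by apply/imsetP; exists (u, x); rewrite ?inE.
apply/existsP; exists (enum_rank (Sub [set u; x] E : edge G)).
rewrite -(cards1 (Sub [set u; x] E : edge G)); apply/eqP/eq_card => e.
rewrite !inE ffunE (inj_eq enum_rank_inj).
have [->|] := eqVneq e (Sub [set u; x] E); last by rewrite andbF.
by rewrite /= !eqxx.
Qed.

(* The k colours need not all be used, which does not affect the minimum. *)
Definition scfc (G : sgraph) (Gc : connected G) : nat := ex_minn (scfc_ex Gc).

(* Main.v *)
Require Import Defs.
From mathcomp Require Import all_boot.

(** The number of colours drops below the number of edges as soon as two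
    distinct edges e and f may share a colour, all other colours being
    distinct.  Whether they may is decided by induced paths on three vertices:
    a geodesic of length one is conflict-free under every colouring, and the
    first two edges of a longer geodesic form an induced path, so it is enough
    that one edge of every induced path has a colour of its own
    ([strongly_cf_connectedI]).  Hence e and f may share a colour unless
    together they form an induced path ([merge_strongly_cf_connected]).

    In a graph where every two edges form an induced path, any two edges meet
    and there is no triangle, which forces one vertex to lie on all edges
    ([centre_or_mergeable]); by connectedness the graph is then a star.

    Conversely, two leaves of a star are joined by a single geodesic, made of
    the two edges at these leaves, so these edges need different colours
    ([unique_geodesic_colours]): a strongly conflict-free colouring of a star
    is injective. *)

Set Implicit Arguments.
Unset Strict Implicit.
Unset Printing Implicit Defensive.

(** * Edges as unordered pairs *)

Section Edges.
Variable G : sgraph.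
Implicit Types (x y z : G) (e f : edge G).

Lemma adj_neq x y : adj x y -> x != y.
Proof. by move=> xy; apply/eqP => E; rewrite E adj_irr in xy. Qed.

Lemma edge_mem x y : adj x y -> [set x; y] \in edges G.
Proof. by move=> xy; apply/imsetP; exists (x, y); rewrite ?inE. Qed.

Definition mkedge x y (xy : adj x y) : edge G := Sub [set x; y] (edge_mem xy).

Lemma edgeP e : exists x y, adj x y /\ val e = [set x; y].
Proof.
have /imsetP[[x y]] := valP e; rewrite inE /= => xy E.
by exists x, y.
Qed.

Lemma card_edge : #|{: edge G}| = #|edges G|.
Proof. by rewrite card_sig; apply: eq_card => e; rewrite !inE. Qed.

Lemma set2_inj x y z : [set x; y] = [set y; z] -> x = z.
Proof.
move=> E; have := set21 x y; rewrite E !inE => /orP[/eqP xy|/eqP //].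
by have := set22 y z; rewrite -E xy !inE orbb => /eqP.
Qed.

End Edges.

(** * Colourings judged on induced paths with three vertices *)

Section Colourings.
Variables (G : sgraph) (Gc : connected G) (k : nat).
Variable c : {ffun edge G -> 'I_k}.

Definition solitary (e : edge G) := forall f, c f = c e -> f = e.

Lemma path_edges_cons (u x : G) (q : seq G) :
  path_edges u (x :: q) = [set u; x] |: path_edges x q.
Proof. by apply/setP=> A; rewrite !inE. Qed.

Lemma path_edges1 (u x : G) : path_edges u [:: x] = [set [set u; x]].
Proof. by apply/setP=> A; rewrite !inE. Qed.

Lemma conflict_freeI (u : G) (p : seq G) (e : edge G) :
    val e \in path_edges u p ->
    (forall f : edge G, val f \in path_edges u p -> c f = c e -> f = e) ->
  conflict_free c u p.
Proof.
move=> ep only_e; apply/existsP; exists (c e); rewrite -(cards1 e).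
apply/eqP/eq_card => f; rewrite in_set in_set1.
by apply/andP/eqP => [[fp /eqP]|->] //; apply: only_e.
Qed.

(** Every geodesic is conflict-free, because of one of its first two edges:
    they form an induced path, a chord being a shortcut. *)
Lemma strongly_cf_connectedI :
    (forall x y z (xy : adj x y) (yz : adj y z), x != z -> ~~ adj x z ->
      solitary (mkedge xy) \/ solitary (mkedge yz)) ->
  strongly_cf_connected Gc c.
Proof.
move=> sol; apply/forallP=> u; apply/forallP=> v; apply/implyP=> uv.
rewrite /dist; case: ex_minnP => n /existsP[p hp] n_min.
apply/existsP; exists p; rewrite hp /=.
case: p hp => [[|x [|y q]] /= /eqP sz] hp.
- by move: hp; rewrite /is_path /= (negPf uv).
- move: hp => /and3P[/= /andP[ux _] _ _].
  apply: (@conflict_freeI _ _ (mkedge ux)); first by rewrite path_edges1 !inE.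
  by move=> f; rewrite path_edges1 inE => /eqP fux _; apply: val_inj.
- move: hp => /and3P[/= /and3P[ux xy yq]].
  rewrite !inE !negb_or.
  move=> /and3P[/and3P[_ uy uq] _ /andP[yq' q_uniq]] lastq.
  have Nuy : ~~ adj u y.
    apply/negP=> adj_uy; suff: n <= (size q).+1 by rewrite -sz ltnn.
    apply: n_min; apply/existsP; exists (in_tuple (y :: q)).
    by rewrite /is_path /= adj_uy yq !inE negb_or uy uq yq' q_uniq lastq.
  case: (sol _ _ _ ux xy uy Nuy) => S.
  + apply: (@conflict_freeI _ _ (mkedge ux)) => [|f _ /S//].
    by rewrite path_edges_cons !inE eqxx.
  + apply: (@conflict_freeI _ _ (mkedge xy)) => [|f _ /S//].
    by rewrite !path_edges_cons !inE eqxx orbT.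
Qed.

(** When y is the only common neighbour of x and z, the path x y z is the only
    geodesic between them, and two edges of the same colour would leave it
    without a colour used once. *)
Lemma unique_geodesic_colours (x y z : G) (xy : adj x y) (yz : adj y z) :
    strongly_cf_connected Gc c -> x != z -> ~~ adj x z ->
    (forall w, adj x w -> adj w z -> w = y) ->
  c (mkedge xy) != c (mkedge yz).
Proof.
move=> /forallP/(_ x)/forallP/(_ z)/implyP cf xz Nxz y_uniq.
have /existsP[p /andP[]] := cf xz.
have dist_le2 : dist Gc x z <= 2.
  rewrite /dist; case: ex_minnP => n _; apply.
  apply/existsP; exists [tuple y; z].
  by rewrite /is_path /= xy yz !inE negb_or xz !adj_neq //= eqxx.
case: p => [[|a [|b [|d q]]] /= /eqP sz]; rewrite -{}sz in dist_le2 => //.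
- by rewrite /is_path /= (negPf xz).
- rewrite /is_path /= => /and3P[/andP[xa _] _ /eqP az].
  by rewrite -az xa in Nxz.
- rewrite /is_path /= => /and3P[/and3P[xa ab _] _ /eqP bz].
  rewrite {b}bz in ab *; rewrite {a xa ab}(y_uniq a xa ab).
  case/existsP=> i /cards1P[e /setP only_e]; apply/eqP => same_colour.
  have := set11 e; rewrite -only_e inE => /andP[e_path /eqP ce].
  have xy_yz : mkedge xy != mkedge yz.
    by apply: contra_neq xz => /(congr1 val) /set2_inj.
  have [cxy cyz] : c (mkedge xy) = i /\ c (mkedge yz) = i.
    suff: e = mkedge xy \/ e = mkedge yz.
      by case=> E; rewrite -ce E same_colour.
    move: e_path; rewrite path_edges_cons path_edges1 !inE.
    by case/orP=> /eqP E; [left|right]; apply: val_inj.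
  have path_xyz g : g = mkedge xy \/ g = mkedge yz ->
      val g \in path_edges x [:: y; z].
    by case=> ->; rewrite path_edges_cons path_edges1 !inE eqxx ?orbT.
  have := only_e (mkedge xy); have := only_e (mkedge yz).
  rewrite 2!in_set 2!in_set1 cxy cyz !path_xyz ?eqxx; [|by left|by right].
  by move=> /esym/eqP Eyz /esym/eqP Exy; rewrite Exy Eyz eqxx in xy_yz.
Qed.

End Colourings.

Lemma scfc_le (G : sgraph) (Gc : connected G) k (c : {ffun edge G -> 'I_k}) :
  strongly_cf_connected Gc c -> scfc Gc <= k.
Proof.
move=> cf; rewrite /scfc; case: ex_minnP => n _; apply.
by apply/existsP; exists c.
Qed.

Lemma scfc_le_edges (G : sgraph) (Gc : connected G) : scfc Gc <= #|edges G|.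
Proof.
rewrite -card_edge; apply: (@scfc_le _ _ _ [ffun e => enum_rank e]).
apply: strongly_cf_connectedI => x y z xy yz _ _; left=> f.
by rewrite !ffunE => /enum_rank_inj.
Qed.

(** * Two edges that may share a colour *)

(** The two edges do not form an induced path: if they meet, they lie in a
    triangle. One orientation suffices, as adjacency is symmetric. *)
Definition mergeable (G : sgraph) (e f : edge G) :=
  forall x y z : G, val e = [set x; y] -> val f = [set y; z] -> adj x z.

Section Merge.
Variables (G : sgraph) (Gc : connected G) (e f : edge G).
Hypotheses (e_neq_f : e != f) (ef : mergeable e f).

Let others : {set edge G} := [set~ f].

Let e_other : e \in others. Proof. by rewrite !inE. Qed.

(** Taking the edges other than f as colours makes all of them but e
    [solitary], with one colour fewer than there are edges. *)
Definition merge_colouring : {ffun edge G -> 'I_#|others|} :=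
  [ffun g => enum_rank_in e_other (if g == f then e else g)].

Lemma merge_solitary g : g != e -> g != f -> solitary merge_colouring g.
Proof.
move=> ge gf h; rewrite !ffunE (negPf gf) => /enum_rank_in_inj E.
have [hf|hf] := eqVneq h f; last first.
  by move: E; rewrite (negPf hf); apply; rewrite !inE.
move: E; rewrite hf eqxx => E; case/eqP: ge.
by rewrite -E // !inE.
Qed.

Lemma merge_strongly_cf_connected : strongly_cf_connected Gc merge_colouring.
Proof.
apply: strongly_cf_connectedI => x y z xy yz xz Nxz.
have [Exy|xy_e] := eqVneq (mkedge xy) e.
  right; apply: merge_solitary; apply: contraNneq Nxz => Eyz.
    by case/eqP: xz; have /(congr1 val)/set2_inj := etrans Exy (esym Eyz).
  by apply: (ef (y := y)); rewrite -?Exy -?Eyz.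
have [Exy|xy_f] := eqVneq (mkedge xy) f.
  right; apply: merge_solitary; apply: contraNneq Nxz => Eyz.
    by rewrite adj_sym; apply: (ef (y := y)); rewrite -?Exy -?Eyz /= setUC.
  by case/eqP: xz; have /(congr1 val)/set2_inj := etrans Exy (esym Eyz).
by left; apply: merge_solitary.
Qed.

Lemma scfc_lt_edges : scfc Gc < #|edges G|.
Proof.
apply: leq_ltn_trans (scfc_le merge_strongly_cf_connected) _.
rewrite -card_edge -cardsT proper_card // properT.
by apply/eqP => /setP/(_ f); rewrite !inE eqxx.
Qed.

End Merge.

(** * Stars *)

Definition covers (G : sgraph) (o : G) :=
  [forall x, forall y, adj x y ==> (x == o) || (y == o)].

Definition is_centre (G : sgraph) (o : G) :=
  forall x y : G, adj x y = ((x == o) != (y == o)).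

Lemma not_covers (G : sgraph) (o : G) : ~~ covers o ->
  exists x y, [/\ adj x y, x != o & y != o].
Proof.
case/forallPn=> x /forallPn[y]; rewrite negb_imply negb_or => /and3P[xy xo yo].
by exists x, y.
Qed.

Lemma disjoint_mergeable (G : sgraph) (e f : edge G) :
  [disjoint val e & val f] -> e != f /\ mergeable e f.
Proof.
move=> dis; split=> [|x y z Ee Ef].
  apply: contraTneq dis => ->; have [x [y [_ ->]]] := edgeP f.
  by apply/pred0Pn; exists x; rewrite /= !inE eqxx.
have /pred0P/(_ y) := dis.
by rewrite /= Ee Ef !inE !eqxx orbT.
Qed.

Lemma triangle_mergeable (G : sgraph) (a b w : G)
    (bw : adj b w) (aw : adj a w) :
  adj a b -> mkedge bw != mkedge aw /\ mergeable (mkedge bw) (mkedge aw).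
Proof.
move=> ab; have ab' := adj_neq ab; split=> [|x y z /= Ebw Eaw].
  apply: contra_neq ab' => /(congr1 val) /=.
  by rewrite [in RHS]setUC => /set2_inj.
have yw : y = w.
  have := set22 x y; have := set21 y z; rewrite -Ebw -Eaw !inE.
  case/orP=> /eqP-> // /orP[/eqP E|/eqP//]; by rewrite E eqxx in ab'.
rewrite {}yw in Ebw Eaw.
have -> : x = b by move: Ebw; rewrite [RHS]setUC => /set2_inj.
have <- : a = z by move: Eaw => /set2_inj.
by rewrite adj_sym.
Qed.

(** Start from an edge ab.  An edge avoiding a either misses ab altogether or
    has the form by; likewise there is an edge az.  The edges by and az are
    disjoint, unless y = z, and then a, b, y is a triangle. *)
Lemma centre_or_mergeable (G : sgraph) (a b : G) : adj a b ->
  (exists o : G, covers o) \/ (exists e f : edge G, e != f /\ mergeable e f).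
Proof.
move=> ab; have [oa|/not_covers[x [y [xy xa ya]]]] := boolP (covers a).
  by left; exists a.
have [ob|/not_covers[x' [z [x'z x'b zb]]]] := boolP (covers b).
  by left; exists b.
right.
have disj (e f : edge G) : [disjoint val e & val f] ->
    exists e f : edge G, e != f /\ mergeable e f.
  by move=> dis; exists e, f; apply: disjoint_mergeable.
have ab_neq := adj_neq ab.
wlog Ex : x y xy xa ya / x = b => [W|].
  have [xb|xb] := eqVneq x b; first exact: (W x y).
  have [yb|yb] := eqVneq y b; first by apply: (W y x); rewrite // adj_sym.
  apply: (disj (mkedge ab) (mkedge xy)); apply/pred0P => t /=.
  rewrite !inE; apply/andP=> -[/orP[]/eqP-> /orP[]];
    by rewrite eq_sym ?(negPf xa) ?(negPf ya) ?(negPf xb) ?(negPf yb).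
wlog Ex' : x' z x'z x'b zb / x' = a => [W|].
  have [x'a|x'a] := eqVneq x' a; first exact: (W x' z).
  have [za|za] := eqVneq z a; first by apply: (W z x'); rewrite // adj_sym.
  apply: (disj (mkedge ab) (mkedge x'z)); apply/pred0P => t /=.
  rewrite !inE; apply/andP=> -[/orP[]/eqP-> /orP[]];
    by rewrite eq_sym ?(negPf x'a) ?(negPf za) ?(negPf x'b) ?(negPf zb).
subst x x'; have [Ey|yz] := eqVneq y z.
  by subst z; exists (mkedge xy), (mkedge x'z); apply: triangle_mergeable.
apply: (disj (mkedge xy) (mkedge x'z)); apply/pred0P => t /=.
rewrite !inE; apply/andP=> -[/orP[]/eqP-> /orP[]];
  by rewrite ?(negPf xa) ?(negPf ya) ?(negPf yz) 1?eq_sym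
    ?(negPf zb) ?(negPf x'b).
Qed.

Lemma has_neighbour (G : sgraph) (x : G) :
  connected G -> 1 < #|G| -> exists y, adj x y.
Proof.
move=> Gc; rewrite -cardsT => /card_gt1P[a [b [_ _ ab]]].
have [y yx] : exists y, x != y.
  by have [->|xa] := eqVneq x a; [exists b | exists a].
have /connectP[[|z p] /=] := Gc x y; first by move=> _ E; rewrite E eqxx in yx.
by case/andP=> xz _ _; exists z.
Qed.

Lemma covers_is_centre (G : sgraph) (o : G) :
  connected G -> 1 < #|G| -> covers o -> is_centre o.
Proof.
move=> Gc G1 /forallP cov.
have covered x y : adj x y -> (x == o) || (y == o).
  by move=> xy; have /forallP/(_ y)/implyP := cov x; apply.
have to_o x : x != o -> adj x o.
  move=> xo; have [y xy] := has_neighbour x Gc G1.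
  by have := covered _ _ xy; rewrite (negPf xo) => /eqP <-.
move=> x y; have [->|xo] := eqVneq x o; have [->|yo] := eqVneq y o => /=.
- exact: adj_irr.
- by rewrite adj_sym to_o.
- exact: to_o.
- by apply/negP => /covered; rewrite (negPf xo) (negPf yo).
Qed.

Lemma centre_edge (G : sgraph) (o : G) : is_centre o ->
  forall e : edge G, exists x, x != o /\ val e = [set o; x].
Proof.
move=> oP e; have [x [y [xy ->]]] := edgeP e.
have xy_neq := adj_neq xy; move: xy; rewrite oP.
have [xo _|xo] := eqVneq x o.
  by exists y; rewrite -xo eq_sym.
have [-> _|//] := eqVneq y o.
by exists x; rewrite setUC.
Qed.

(** The edges of a star correspond to its vertices other than the centre. *)
Lemma centre_card (G : sgraph) (o : G) : is_centre o -> #|G| = #|edges G|.+1.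
Proof.
move=> oP; rewrite (cardD1 o) add1n; congr _.+1.
have -> : edges G = [set [set o; x] | x in [predD1 G & o]].
  apply/setP => A; apply/idP/imsetP => [AE|[x]].
    have [x [xo E]] := centre_edge oP (Sub A AE : edge G).
    by exists x; rewrite ?inE ?xo.
  by rewrite !inE andbT => xo ->; apply: edge_mem; rewrite oP eqxx (negPf xo).
by rewrite card_imset // => x y; rewrite (setUC [set o] [set x]) => /set2_inj.
Qed.

Lemma isomorphic_starP (G : sgraph) :
  isomorphic G (star #|edges G|) <-> exists o : G, is_centre o.
Proof.
split=> [[f f_bij f_adj]|[o oP]].
  have [g fK gK] := f_bij; exists (g ord0) => x y.
  by rewrite -f_adj /= /star_adj !(can2_eq fK gK).
(* enumerate the vertices, then exchange the rank of the centre and 0 *)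
have cardG := centre_card oP.
pose r x : 'I_#|edges G|.+1 := cast_ord cardG (enum_rank x).
have r_inj : injective r by move=> x y /cast_ord_inj/enum_rank_inj.
pose f x : star #|edges G| :=
  if x == o then ord0 else if r x == ord0 then r o else r x.
have f0 x : (f x == ord0) = (x == o).
  rewrite /f; have [|xo] := eqVneq x o; first by rewrite eqxx.
  have [rx|/negPf//] := eqVneq (r x) ord0.
  by rewrite -rx (inj_eq r_inj) eq_sym (negPf xo).
have f_inj : injective f.
  move=> x y E; have Eo : (x == o) = (y == o) by rewrite -!f0 E.
  have [yo|yo] := eqVneq y o; first by apply/eqP; rewrite yo Eo yo.
  have xo : x != o by rewrite Eo.
  move: E; rewrite /f (negPf xo) (negPf yo).
  case: ifP => rx; case: ifP => ry; last exact: r_inj.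
  - by move=> _; apply: r_inj; rewrite (eqP rx) (eqP ry).
  - by move/r_inj=> E; rewrite E eqxx in yo.
  - by move/r_inj=> E; rewrite E eqxx in xo.
exists f; last by move=> x y; rewrite /= /star_adj !f0 oP.
by apply: inj_card_bij => //; rewrite card_ord cardG.
Qed.

(** Two edges of a star form the only geodesic between their leaves, so a
    strongly conflict-free colouring is injective. *)
Lemma centre_scfc_ge (G : sgraph) (Gc : connected G) (o : G) :
  is_centre o -> #|edges G| <= scfc Gc.
Proof.
move=> oP; rewrite /scfc; case: ex_minnP => k /existsP[c cf] _.
rewrite -card_edge -[k]card_ord; apply: (@leq_card _ _ c) => e f cef.
have [x [xo Ee]] := centre_edge oP e; have [y [yo Ef]] := centre_edge oP f.
have [xy|xy] := eqVneq x y; first by apply: val_inj; rewrite Ee Ef xy.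
have x_o : adj x o by rewrite oP (negPf xo) eqxx.
have o_y : adj o y by rewrite oP (negPf yo) eqxx.
have xoE : mkedge x_o = e by apply: val_inj; rewrite Ee /= setUC.
have oyE : mkedge o_y = f by apply: val_inj; rewrite Ef.
suff: c e != c f by rewrite cef eqxx.
rewrite -xoE -oyE; apply: unique_geodesic_colours cf xy _ _.
  by rewrite oP (negPf xo) (negPf yo).
by move=> w; rewrite oP (negPf xo); case: (eqVneq w o).
Qed.

Theorem theorem4p5 (G : sgraph) (Gc : connected G) (G_nontrivial : 1 < #|G|)
    (m : nat) (Gm : #|edges G| = m) :
  scfc Gc = m <-> isomorphic G (star m).
Proof.
rewrite -{m}Gm; split=> [scfcE|/isomorphic_starP[o oP]]; last first.
  by apply/eqP; rewrite eqn_leq scfc_le_edges (centre_scfc_ge Gc oP).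
have /card_gt0P[a _] : 0 < #|G| by apply: ltnW.
have [b ab] := has_neighbour a Gc G_nontrivial.
have [[o o_cov]|[e [f [e_neq_f ef]]]] := centre_or_mergeable ab.
  by apply/isomorphic_starP; exists o; apply: covers_is_centre.
by have := scfc_lt_edges Gc e_neq_f ef; rewrite scfcE ltnn.
Qed.
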